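(* Let $-1<\alpha<0<\beta$ and let $n\geqslant5$ be an integer. Then the zeros of $\phi_n^{(\alpha+1,\beta+1)}(\mu)$ and $\phi_{n-2}^{(\alpha+1,\beta+1)}(\mu)$ interlace, and the zeros of $\phi_n^{(\alpha,\beta)}(\mu)$ and $\phi_{n-2}^{(\alpha,\beta)}(\mu)$ interlace.
   Context: For real $a$ and integer $m\geqslant0$, $(a)_m=a(a+1)\cdots(a+m-1)$, $(a)_0=1$. The Jacobi polynomial is $P_n^{(\alpha,\beta)}(x)=\frac{(\alpha+1)_n}{n!}\sum_{k=0}^{n}\frac{(-n)_k(n+\alpha+\beta+1)_k}{k!\,(\alpha+1)_k}\big(\frac{1-x}{2}\big)^k$, and $$\phi_n^{(\alpha,\beta)}(\mu)=\sum_{k=0}^{[n/2]}\Big(\tfrac{d^{2k}}{dx^{2k}}P_n^{(\alpha,\beta)}(x)\Big)\Big|_{x=1}\mu^k=\frac{(\alpha+1)_n}{n!}\sum_{k=0}^{[n/2]}\frac{(-n)_{2k}(n+\alpha+\beta+1)_{2k}}{(\alpha+1)_{2k}}\Big(\frac{\mu}{4}\Big)^k .$$ Two real polynomials interlace (strictly) if all their zeros are real, simple and mutually distinct, and between any two consecutive zeros of either polynomial there is exactly one zero of the other. *)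

(* Defs.v *)
From HB Require Import structures.
From mathcomp Require Import all_boot all_order all_algebra.
Set Implicit Arguments. Unset Strict Implicit. Unset Printing Implicit Defensive.
Import Order.TTheory GRing.Theory Num.Theory.
Local Open Scope ring_scope.

Definition poch {R : ringType} (a : R) (m : nat) : R :=
  \prod_(i < m) (a + i%:R).

Definition phi {R : fieldType} (n : nat) (al be : R) : {poly R} :=
  (poch (al + 1) n / (n`!)%:R) *:
  \sum_(k < (n./2).+1)
     ((poch (- n%:R) (2 * k) * poch (n%:R + al + be + 1) (2 * k)
        / poch (al + 1) (2 * k)) / 4 ^+ k) *: 'X^k.

Definition real_simple_zeros {R : fieldType} (p : {poly R}) : Prop :=
  p != 0 /\
  exists s : seq R, uniq s /\ p = lead_coef p *: \prod_(x <- s) ('X - x%:P).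

Definition sep_by {R : realFieldType} (p q : {poly R}) : Prop :=
  forall x y : R, root p x -> root p y -> x < y ->
    (forall z, x < z < y -> ~~ root p z) ->
    exists! z, x < z < y /\ root q z.

Definition interlace {R : realFieldType} (p q : {poly R}) : Prop :=
  [/\ real_simple_zeros p, real_simple_zeros q,
      (forall x, ~ (root p x /\ root q x)),
      sep_by p q & sep_by q p].

(* Main.v *)
(* Put t = (1 - x) / 2.  Up to a positive factor and the scaling mu = 4 nu, the polynomials
   phi_n^(al,be) and phi_{n-1}^(al+1,be+1) are E_n and O_n, where
   F_n(z) = sum_k z^k D^k P_n |_{t=0} = E_n(z^2) - z O_n(z^2) and P_n is the Jacobi
   polynomial, orthogonal for w = t^al (1-t)^be.  If u solves u - z u' = p and u(0) = 0,
   where p is the combination of P_n and P_{n-1} that makes u(0) vanish, then testing the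
   equation against the conjugate of u' and integrating uu'w by parts gives
   Re (F_n / F_{n-1}) > 0 on the imaginary axis, because w' < 0 for al <= 0 < be; that is,
   E_n E_{n-1} - nu O_n O_{n-1} > 0 for nu < 0.  Evaluating this at the zeros, by induction
   the zeros alternate in each of the pairs (E_n, O_n), (E_{n-1}, O_n), (E_n, O_{n-1}).
   Moreover a first order differential relation between E_n and E_{n-1} (and between O_n and
   O_{n-1}) shows that the i-th zero increases with n.  Then
   e_{i+1}(n) < o_i(n-1) < e_i(n-2) < e_i(n-1) < e_i(n) and
   o_{i+1}(n) < e_{i+1}(n-1) < o_i(n-2) < o_i(n-1) < o_i(n).
   Integrals of polynomials are replaced by the explicit moments of the beta distribution. *)
Require Import Defs.
From HB Require Import structures.
From mathcomp Require Import all_boot all_order all_algebra.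
From mathcomp Require Import ring lra zify polyorder polyrcf.
Import Order.TTheory GRing.Theory Num.Theory.
Set Implicit Arguments. Unset Strict Implicit. Unset Printing Implicit Defensive.
Local Open Scope ring_scope.

(** * Beta moments and Jacobi polynomials *)

Lemma poch0 (R : fieldType) (a : R) : poch a 0 = 1.
Proof. by rewrite /poch big_ord0. Qed.

Lemma pochS (R : fieldType) (a : R) m : poch a m.+1 = poch a m * (a + m%:R).
Proof. by rewrite /poch big_ord_recr. Qed.

Lemma pochSl (R : fieldType) (a : R) m : poch a m.+1 = a * poch (a + 1) m.
Proof.
rewrite /poch big_ord_recl addr0; congr (_ * _); apply: eq_bigr => i _.
by rewrite lift0 -natr1; ring.
Qed.

Lemma poch_gt0 (R : realFieldType) (a : R) m : 0 < a -> 0 < poch a m.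
Proof. by move=> a0; apply: prodr_gt0 => i _; rewrite ltr_wpDr. Qed.

(** Reduces identities that are linear in a polynomial to monomials, whose beta moments are
    explicit. *)
Lemma poly_monomial_ind (R : nzRingType) (P : {poly R} -> Prop) :
  P 0 -> (forall c n p, P p -> P (c *: 'X^n + p)) -> forall p, P p.
Proof.
move=> P0 PS p; rewrite -[p]coefK poly_def.
elim: (size p) => [|n IH]; first by rewrite big_ord0.
by rewrite big_ord_recr /= addrC; apply: PS.
Qed.

(* The expectation of [p] under the beta distribution of parameters [a] and [b - a]. *)
Definition beta_moment {R : fieldType} (a b : R) (p : {poly R}) : R :=
  \sum_(i < size p) p`_i * (poch a i / poch b i).

Lemma beta_moment_wide (R : fieldType) (a b : R) (p : {poly R}) m :
  (size p <= m)%N ->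
  beta_moment a b p = \sum_(i < m) p`_i * (poch a i / poch b i).
Proof.
move=> sp; rewrite /beta_moment.
rewrite (big_ord_widen m (fun i => p`_i * (poch a i / poch b i))) // big_mkcond.
apply: eq_bigr => i _; case: ifPn => //; rewrite -leqNgt => le.
by rewrite nth_default // mul0r.
Qed.

Lemma beta_moment_linear (R : fieldType) (a b : R) :
  linear_for *%R (@beta_moment R a b).
Proof.
move=> c p q; set m := maxn (size p) (size q).
rewrite !(@beta_moment_wide _ a b _ m) ?leq_maxl ?leq_maxr //; last first.
  rewrite (leq_trans (size_polyD _ _)) // geq_max leq_maxr andbT.
  by rewrite (leq_trans (size_scale_leq _ _)) ?leq_maxl.
rewrite mulr_sumr -big_split; apply: eq_bigr => i _ /=.
by rewrite coefD coefZ; ring.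
Qed.

HB.instance Definition _ (R : fieldType) (a b : R) :=
  GRing.isLinear.Build R {poly R} R *%R (@beta_moment R a b)
    (@beta_moment_linear R a b).

Lemma beta_momentD (R : fieldType) (a b : R) :
  {morph @beta_moment R a b : p q / p + q}.
Proof. exact: linearD. Qed.

Lemma beta_momentZ (R : fieldType) (a b c : R) (p : {poly R}) :
  beta_moment a b (c *: p) = c * beta_moment a b p.
Proof. exact: linearZ. Qed.

Lemma beta_momentXn (R : fieldType) (a b : R) m :
  beta_moment a b 'X^m = poch a m / poch b m.
Proof.
rewrite (@beta_moment_wide _ _ _ _ m.+1) ?size_polyXn // big_ord_recr /=.
rewrite big1 ?add0r => [|i _]; first by rewrite coefXn eqxx mul1r.
by rewrite coefXn ltn_eqF ?mul0r.
Qed.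

(** A factor 1 - t raises the exponent of 1 - t in the weight by one, that is, [b] becomes [b + 1];
    (b - a) / b is the ratio of the two normalising constants. *)
Lemma beta_moment_mulX1X (R : realFieldType) (a b : R) (p : {poly R}) :
  0 < b ->
  beta_moment a b ((1 - 'X) * p) = (b - a) / b * beta_moment a (b + 1) p.
Proof.
move=> b0; elim/poly_monomial_ind: p => [|c n p IH].
  by rewrite mulr0 !linear0 mulr0.
rewrite mulrDr !linearD /= IH mulrDr; congr (_ + _).
rewrite -scalerAr !linearZ /= mulrBl mul1r -exprS linearB /= !beta_momentXn.
have := pochSl b n; rewrite !pochS => E.
have p0 := poch_gt0 n b0; have p1 := poch_gt0 n (ltr_wpDr ler01 b0).
have bn : 0 < b + n%:R by rewrite ltr_wpDr.
have -> : poch (b + 1) n = poch b n * (b + n%:R) / b.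
  by rewrite E mulrAC divff ?mul1r // gt_eqF.
by field; rewrite !gt_eqF.
Qed.

Lemma beta_moment_mulX (R : realFieldType) (a b : R) (p : {poly R}) :
  0 < b ->
  beta_moment a b ('X * p) = a / b * beta_moment (a + 1) (b + 1) p.
Proof.
move=> b0; elim/poly_monomial_ind: p => [|c n p IH].
  by rewrite mulr0 !linear0 mulr0.
rewrite mulrDr !linearD /= IH mulrDr; congr (_ + _).
rewrite -scalerAr !beta_momentZ -exprS !beta_momentXn !pochSl.
have p1 : 0 < poch (b + 1) n by apply: poch_gt0; lra.
by field; rewrite !gt_eqF.
Qed.

Lemma beta_moment_mulX_X1 (R : realFieldType) (a b : R) (p : {poly R}) :
  0 < b -> beta_moment a b ('X * ((1 - 'X) * p)) =
  a * (b - a) / (b * (b + 1)) * beta_moment (a + 1) (b + 2) p.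
Proof.
move=> b0; rewrite beta_moment_mulX // beta_moment_mulX1X; last by lra.
have -> : b + 1 + 1 = b + 2 by ring.
by field; rewrite !gt_eqF //; lra.
Qed.

(** * The Jacobi operator and its polynomial eigenfunctions *)

Definition jacobi_op {R : fieldType} (a b : R) (p : {poly R}) : {poly R} :=
  'X * ((1 - 'X) * p^`()^`()) + (a%:P - b *: 'X) * p^`().

Arguments jacobi_op : simpl never.

Lemma jacobi_op_linear (R : fieldType) (a b : R) : linear (@jacobi_op R a b).
Proof.
move=> c p q; rewrite /jacobi_op !(derivD, derivZ).
rewrite -!mul_polyC; ring.
Qed.

HB.instance Definition _ (R : fieldType) (a b : R) :=
  GRing.isLinear.Build R {poly R} {poly R} *:%R (@jacobi_op R a b)
    (@jacobi_op_linear R a b).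

Lemma jacobi_opXn (R : fieldType) (a b : R) (n : nat) :
  jacobi_op a b 'X^n =
  (- (n%:R * (n%:R + b - 1))) *: 'X^n + (n%:R * (n%:R + a - 1)) *: 'X^(n.-1).
Proof.
case: n => [|[|n]].
- by rewrite /jacobi_op !derivE !mul0r oppr0 !scale0r !mulr0 addr0.
- rewrite /jacobi_op !derivE /= expr0 !mulr0 add0r mulr1 expr1 -!mul_polyC.
  by rewrite mulr1n !mul1r ![1 + _]addrC !addrK polyCN; ring.
- have D m : ('X^(m.+1))^`() = m.+1%:R *: 'X^m :> {poly R}.
    by rewrite derivXn scaler_nat.
  rewrite /jacobi_op D derivZ D [n.+2.-1]/=; rewrite -!natr1 -!mul_polyC.
  by rewrite !(polyCM, polyCD, polyCN, polyC1) !exprS; ring.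
Qed.

(* [jacobi_op a b] is [p |-> w^-1 (t (1 - t) w p')'] for [w = t^(a-1) (1-t)^(b-a-1)],
   and this is its integration by parts. *)
Lemma beta_moment_jacobi_op (R : realFieldType) (a b : R) (p q : {poly R}) :
  0 < a -> 0 < b -> beta_moment a b (jacobi_op a b p * q) =
  - (a * (b - a) / (b * (b + 1)) * beta_moment (a + 1) (b + 2) (p^`() * q^`())).
Proof.
move=> a0 b0; set k := a * (b - a) / _.
elim/poly_monomial_ind: p => [|c i p IH].
  by rewrite !linear0 !mul0r !linear0 mulr0 oppr0.
rewrite jacobi_op_linear derivD derivZ [in LHS]mulrDl [in RHS]mulrDl.
rewrite [in LHS]beta_momentD [in RHS]beta_momentD IH mulrDr opprD; congr (_ + _).
rewrite -!scalerAl !beta_momentZ mulrCA -mulrN; congr (_ * _) => {c IH p}.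
elim/poly_monomial_ind: q => [|c j q IH].
  by rewrite !linear0 !mulr0 !linear0 mulr0 oppr0.
rewrite derivD derivZ [in LHS]mulrDr [in RHS]mulrDr.
rewrite [in LHS]beta_momentD [in RHS]beta_momentD IH mulrDr opprD; congr (_ + _).
rewrite -!scalerAr !beta_momentZ mulrCA -mulrN; congr (_ * _) => {c IH q}.
rewrite /k jacobi_opXn mulrDl -!scalerAl -!exprD beta_momentD !beta_momentZ !beta_momentXn.
rewrite !derivXn -!scaler_nat -scalerAl -scalerAr !beta_momentZ -exprD.
rewrite beta_momentXn.
have H (x : R) m : 0 < x -> poch x m != 0 by move=> x0; rewrite gt_eqF ?poch_gt0.
have H' (x : R) m : 0 < x -> x + m%:R != 0 by move=> x0; rewrite gt_eqF ?ltr_wpDr.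
case: i => [|i]; first by rewrite !mul0r oppr0 !mul0r addr0 mulr0 oppr0.
(* For j = 0 the right side vanishes and the two moments coming from [jacobi_opXn] cancel. *)
case: j => [|j].
  rewrite !addn0 mul0r !mulr0 oppr0 /= !pochS.
  have := H a i a0; have := H b i b0; have := H' b i b0; rewrite -natr1.
  by move=> *; field; apply/andP.
rewrite /= !addSn !addnS /= !pochS; set s := (i + j)%N.
(* All moments are brought to the common factor [poch a s / poch b s]. *)
have -> : poch (a + 1) s = poch a s * (a + s%:R) / a.
  by rewrite -pochS pochSl; field; rewrite gt_eqF.
have E : poch (b + 2) s * (b * (b + 1)) = poch b s * (b + s%:R) * (b + s%:R + 1).
  have := pochSl b s.+1; rewrite (pochSl (b + 1)) !pochS -natr1 -addrA.
  have -> : 1 + 1 = 2 :> R by ring.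
  by move=> E; transitivity (b * ((b + 1) * poch (b + 2) s)); [ring | rewrite -E; ring].
have -> : poch (b + 2) s = poch b s * (b + s%:R) * (b + s%:R + 1) / (b * (b + 1)).
  by rewrite -E; field; rewrite !gt_eqF; lra.
have := H b s b0; have := H' b s b0; have := H' b s.+1 b0.
rewrite -!natr1 addrA => h1 h2 h3.
rewrite /s natrD.
field; rewrite -natrD h1 h2 h3 !gt_eqF //; lra.
Qed.

(** The [k]-th derivative at 0 of [jacobi a b n], without the 1/k! of the Taylor coefficient. Here a
    = alpha + 1 and b = alpha + beta + 1, so the matching beta weight is that of [a] and [b + 1]. *)
Definition jacobi_coef {R : fieldType} (a b : R) (n k : nat) : R :=
  poch (- n%:R) k * poch (n%:R + b) k / poch a k.

(* The Jacobi polynomial P_n^(a-1, b-a) at 1 - 2t, normalised to be 1 at t = 0. *)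
Definition jacobi {R : fieldType} (a b : R) (n : nat) : {poly R} :=
  \poly_(k < n.+1) (jacobi_coef a b n k / (k`!)%:R).

Lemma pochN_eq0 (R : fieldType) (n k : nat) :
  (n < k)%N -> poch (- n%:R : R) k = 0.
Proof.
move=> nk; rewrite /poch (bigD1 (Ordinal nk)) //=.
by rewrite addNr mul0r.
Qed.

Lemma pochN_gt0 (R : realFieldType) (n k : nat) :
  (k <= n)%N -> 0 < (-1) ^+ k * poch (- n%:R : R) k.
Proof.
elim: k => [|k IH] kn; first by rewrite poch0 mulr1.
have -> : (-1) ^+ k.+1 * poch (- n%:R : R) k.+1 =
   ((-1) ^+ k * poch (- n%:R : R) k) * (n%:R - k%:R).
  by rewrite pochS exprS; ring.
by apply: mulr_gt0; [exact: IH (ltnW kn) | rewrite subr_gt0 ltr_nat].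
Qed.

Lemma jacobi_coef_eq0 (R : fieldType) (a b : R) (n k : nat) :
  (n < k)%N -> jacobi_coef a b n k = 0.
Proof. by move=> nk; rewrite /jacobi_coef pochN_eq0 // !mul0r. Qed.

Lemma jacobi_coef_gt0 (R : realFieldType) (a b : R) (n k : nat) :
  0 < a -> 0 < n%:R + b -> (k <= n)%N -> 0 < (-1) ^+ k * jacobi_coef a b n k.
Proof.
move=> a0 b0 kn; rewrite /jacobi_coef !mulrA.
apply: divr_gt0; last exact: poch_gt0.
by apply: mulr_gt0; [exact: pochN_gt0 | exact: poch_gt0].
Qed.

Lemma jacobi_coef0 (R : fieldType) (a b : R) (n : nat) : jacobi_coef a b n 0 = 1.
Proof. by rewrite /jacobi_coef !poch0 !mul1r invr1. Qed.

Lemma jacobi_coefS (R : realFieldType) (a b : R) (n k : nat) : 0 < a ->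
  (a + k%:R) * jacobi_coef a b n k.+1 =
  (k%:R - n%:R) * (n%:R + b + k%:R) * jacobi_coef a b n k.
Proof.
move=> a0; rewrite /jacobi_coef !pochS.
have p0 := poch_gt0 k a0.
by field; rewrite !gt_eqF // ltr_wpDr.
Qed.

Lemma coef_jacobi (R : fieldType) (a b : R) (n k : nat) :
  (jacobi a b n)`_k = jacobi_coef a b n k / (k`!)%:R.
Proof.
rewrite coef_poly; case: ltnP => // nk.
by rewrite jacobi_coef_eq0 // mul0r.
Qed.

Lemma size_jacobi (R : realFieldType) (a b : R) (n : nat) :
  0 < a -> 0 < n%:R + b -> size (jacobi a b n) = n.+1.
Proof.
move=> a0 b0; rewrite /jacobi size_poly_eq //.
rewrite mulf_neq0 // ?invr_eq0 ?pnatr_eq0 -?lt0n ?fact_gt0 //.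
by have := jacobi_coef_gt0 a0 b0 (leqnn n); apply: contraTneq => ->; rewrite mulr0 ltxx.
Qed.

Lemma coefXderiv (R : nzRingType) (p : {poly R}) (k : nat) :
  ('X * p^`())`_k = k%:R * p`_k.
Proof. by rewrite coefXM coef_deriv mulr_natl; case: k => //=; rewrite mulr0n. Qed.

(** Compared coefficient by coefficient, the hypergeometric equation is the two-term recurrence
    [jacobi_coefS]. *)
Lemma jacobi_op_jacobi (R : realFieldType) (a b : R) (n : nat) : 0 < a ->
  jacobi_op a (b + 1) (jacobi a b n) = - (n%:R * (n%:R + b)) *: jacobi a b n.
Proof.
move=> a0; apply/polyP => k; rewrite coefZ.
have fk (m : nat) : ((m`!)%:R : R) != 0 by rewrite pnatr_eq0 -lt0n fact_gt0.
have E : (k.+1%:R * (k%:R + a)) * (jacobi a b n)`_k.+1 =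
    (k%:R - n%:R) * (n%:R + b + k%:R) * (jacobi a b n)`_k.
  have := jacobi_coefS b n k a0; rewrite !coef_jacobi factS natrM => e.
  rewrite [RHS]mulrA -e; field; by rewrite fk nat1r pnatr_eq0.
have -> : (jacobi_op a (b + 1) (jacobi a b n))`_k =
    (k.+1%:R * (k%:R + a)) * (jacobi a b n)`_k.+1
     - k%:R * (k%:R + b) * (jacobi a b n)`_k; last first.
  by rewrite E; ring.
move: (jacobi a b n) => p {E fk}.
rewrite /jacobi_op mulrBl mul1r mulrBr mulrBl -scalerAl mul_polyC.
have D q i : (q^`())`_i = i.+1%:R * q`_i.+1 :> R by rewrite coef_deriv mulr_natl.
rewrite !(coefD, coefN, coefZ) !coefXderiv D coefXM.
case: k => [|k] /=; first by rewrite !mul0r; ring.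
by rewrite coefXderiv !D -!natr1; ring.
Qed.

Lemma jacobi_op_sym (R : realFieldType) (a b : R) (p q : {poly R}) :
  0 < a -> 0 < b ->
  beta_moment a b (jacobi_op a b p * q) = beta_moment a b (p * jacobi_op a b q).
Proof.
move=> a0 b0; rewrite [p * _]mulrC !beta_moment_jacobi_op //.
by rewrite [q^`() * _]mulrC.
Qed.

(* [jacobi_op] is symmetric, triangular on monomials, and has distinct eigenvalues. *)
Lemma jacobi_orthogonal (R : realFieldType) (a b : R) (n : nat) (q : {poly R}) :
  0 < a -> 0 < b + 1 -> 0 < n%:R + b -> (size q <= n)%N ->
  beta_moment a (b + 1) (jacobi a b n * q) = 0.
Proof.
move=> a0 b1 b0 sq.
suff H m : (m < n)%N -> beta_moment a (b + 1) (jacobi a b n * 'X^m) = 0.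
  rewrite -[q]coefK poly_def mulr_sumr linear_sum big1 // => i _ /=.
  by rewrite -scalerAr beta_momentZ H ?mulr0 // (leq_trans (ltn_ord i)).
elim: m => [|m IH] mn.
  have := jacobi_op_sym (jacobi a b n) 'X^0 a0 b1.
  rewrite jacobi_op_jacobi // -scalerAl jacobi_opXn (mulrDr (jacobi a b n)) -!scalerAr.
  rewrite beta_momentD !beta_momentZ !mul0r oppr0 !mul0r addr0 => /eqP.
  by rewrite mulf_eq0 oppr_eq0 mulf_eq0 pnatr_eq0 gtn_eqF //= gt_eqF //= => /eqP.
have := jacobi_op_sym (jacobi a b n) 'X^(m.+1) a0 b1.
rewrite jacobi_op_jacobi // -scalerAl jacobi_opXn (mulrDr (jacobi a b n)) -!scalerAr.
rewrite beta_momentD !beta_momentZ IH ?(ltnW mn) // mulr0 addr0 => /eqP.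
(* The eigenvalues in degrees n and m + 1 differ, up to sign, by (n - m - 1)(n + m + 1 + b), which
   is nonzero. *)
rewrite -subr_eq0 -mulrBl mulf_eq0 => /orP[/eqP E|/eqP //]; exfalso.
have xy : m.+1%:R < n%:R :> R by rewrite ltr_nat.
have x0 : 0 <= m.+1%:R :> R by exact: ler0n.
move: (m.+1%:R) (n%:R) E b0 x0 xy => x y E y0 x0 xy.
have : (y - x) * (y + x + b) = 0 by rewrite -oppr0 -E; ring.
by apply/eqP; rewrite mulf_neq0 // gt_eqF //; lra.
Qed.

Lemma size_sub_lead (R : fieldType) (p q : {poly R}) (n : nat) :
  size p = n.+1 -> size q = n.+1 ->
  (size (p - (lead_coef p / lead_coef q) *: q)%R <= n)%N.
Proof.
move=> sp sq; have q0 : lead_coef q != 0 by rewrite lead_coef_eq0 -size_poly_eq0 sq.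
apply/leq_sizeP => j; rewrite leq_eqVlt => /predU1P[<-|nj].
  rewrite coefB coefZ !lead_coefE sp sq /= divfK ?subrr //.
  by move: q0; rewrite lead_coefE sq.
by rewrite coefB coefZ !nth_default ?sp ?sq // mulr0 subrr.
Qed.

(** Positivity without integrals, by induction on the degree for all parameters at once. With j the
    Jacobi polynomial of degree n, p = c j + r is an orthogonal splitting with r of smaller degree.
    Integration by parts expresses n (n + b - 1) times the squared norm of j through the squared
    norm of its derivative, for the parameters a + 1 and b + 2. *)
Lemma beta_moment_sqr_gt0 (R : realFieldType) (a b : R) (p : {poly R}) :
  0 < a -> a < b -> p != 0 -> 0 < beta_moment a b (p * p).
Proof.
move: {2}(size p) (leqnn (size p)) => n.
elim: n a b p => [|n IH] a b p; first by rewrite leqn0 size_poly_eq0 => ->.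
move=> sp a0 ab p0; have b0 := lt_trans a0 ab.
have [{}sp|{}sp] : (size p <= n)%N \/ size p = n.+1 by lia.
  exact: IH.
(* Constants are treated apart, since in degree 0 the eigenvalue vanishes and says nothing about the
   norm. *)
have [n0|n_gt0] := posnP n.
  have Ep := size1_polyC (eq_leq (etrans sp (congr1 S n0))).
  move: p0; rewrite Ep polyC_eq0 -polyCM -alg_polyC beta_momentZ => c0.
  rewrite -(expr0 'X) beta_momentXn !poch0 divr1 mulr1.
  by rewrite -expr2 exprn_even_gt0.
have nb : 0 < n%:R + (b - 1) by have : 1 <= n%:R :> R; [rewrite ler1n | lra].
pose j := jacobi a (b - 1) n.
have sj : size j = n.+1 by rewrite size_jacobi.
have b1 : 0 < b - 1 + 1 by lra.
have oj (q : {poly R}) : (size q <= n)%N -> beta_moment a b (j * q) = 0.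
  by move=> sq; rewrite -[b](subrK 1) jacobi_orthogonal.
have j2 : 0 < beta_moment a b (j * j).
  have := beta_moment_jacobi_op j j a0 b0.
  rewrite -{1 2}[b](subrK 1) jacobi_op_jacobi // subrK -scalerAl beta_momentZ mulNr.
  move=> /oppr_inj.
  have : 0 < beta_moment (a + 1) (b + 2) (j^`() * j^`()).
    apply: IH; rewrite -?size_poly_eq0 ?size_deriv ?sj -?lt0n //; lra.
  have : 0 < a * (b - a) / (b * (b + 1)).
    by rewrite divr_gt0 ?mulr_gt0 //; lra.
  have n1 : 0 < n%:R :> R by rewrite ltr0n.
  by move=> k0 d0 e; have := mulr_gt0 k0 d0; rewrite -e pmulr_rgt0 // mulr_gt0.
have [c [r [Ep sr]]] : exists c (r : {poly R}), p = c *: j + r /\ (size r <= n)%N.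
  exists (lead_coef p / lead_coef j), (p - (lead_coef p / lead_coef j) *: j).
  by split; [rewrite addrC subrK | exact: size_sub_lead].
have -> : p * p = c ^+ 2 *: (j * j) + ((2 * c) *: (j * r) + r * r).
  by rewrite Ep -!mul_polyC !(polyCM, polyC_exp); ring.
rewrite beta_momentD beta_momentZ [X in _ + X]beta_momentD beta_momentZ (oj r) // mulr0 add0r.
have [r0|r0] := eqVneq r 0.
  rewrite r0 mul0r linear0 addr0 pmulr_lgt0 // exprn_even_gt0 //=.
  by apply: contraNneq p0 => c0; rewrite Ep c0 r0 scale0r addr0.
by rewrite ltr_wpDl ?IH // mulr_ge0 ?sqr_ge0 // ltW.
Qed.

(** * The energy inequality *)

(** Integration by parts: the factor 1 - t turns the weight into t^(a-1) (1-t)^(b-a), whose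
    derivative is then moved onto the other factor. *)
Lemma beta_moment_deriv (R : realFieldType) (a b : R) (g : {poly R}) :
  0 < b -> beta_moment a b ((1 - 'X) * ('X * g)^`()) =
  beta_moment a b (((b - 1) *: 'X - (a - 1)%:P) * g).
Proof.
move=> b0; elim/poly_monomial_ind: g => [|c i g IH].
  by rewrite !mulr0 linear0 mulr0.
rewrite !(mulrDr, derivD) !beta_momentD IH; congr (_ + _) => {g IH}.
rewrite -!scalerAr -exprS derivZ -scalerAr !beta_momentZ; congr (_ * _).
rewrite derivXn /= -scaler_nat -scalerAr beta_momentZ !mulrBl mul1r -exprS.
rewrite -scalerAl -exprS mul_polyC !linearB /= !linearZ /= !beta_momentXn !pochS -natr1.
have := poch_gt0 i b0 => p0.
by field; rewrite !gt_eqF // ltr_wpDr.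
Qed.

(* Integration by parts against [t^(a-1) (1-t)^(b-a)], which is nonincreasing on ]0, 1[. *)
Lemma beta_moment_mul_deriv_gt0 (R : realFieldType) (a b : R) (q : {poly R}) :
  0 < a -> a <= 1 -> a < b -> q.[0] = 0 -> q != 0 ->
  0 < beta_moment a (b + 1) (q * q^`()).
Proof.
move=> a0 a1 ab q0 qn0; have b0 := lt_trans a0 ab.
have [v Eq] : exists v, q = 'X * v.
  have /factor_theorem[v ->] : root q 0 by apply/rootP.
  by exists v; rewrite subr0 mulrC.
have vn0 : v != 0 by apply: contraNneq qn0 => v0; rewrite Eq v0 mulr0.
have : 0 < beta_moment a b ((1 - 'X) * ('X * ('X * (v * v)))^`()).
  rewrite beta_moment_deriv //.
  (* With q = t v, split (b - 1) t - (a - 1) = (b - a) t + (1 - a)(1 - t); the assumptions on [a]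
     and [b] make both coefficients nonnegative and the first positive. *)
  have -> : ((b - 1) *: 'X - (a - 1)%:P) * ('X * (v * v)) =
     (b - a) *: (q * q) + (1 - a) *: ('X * ((1 - 'X) * (v * v))).
    by rewrite Eq -!mul_polyC !(polyCB, polyC1); ring.
  rewrite beta_momentD !beta_momentZ beta_moment_mulX_X1 // ltr_wpDr //.
    apply: mulr_ge0; first by lra.
    apply: mulr_ge0; last by apply/ltW/beta_moment_sqr_gt0 => //; lra.
    by apply: divr_ge0; apply: mulr_ge0; lra.
  by apply: mulr_gt0; [lra | exact: beta_moment_sqr_gt0].
have -> : ('X * ('X * (v * v)))^`() = 2 *: (q * q^`()).
  have -> : 'X * ('X * (v * v)) = q * q by rewrite Eq; ring.
  by rewrite derivM -mul_polyC; ring.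
rewrite beta_moment_mulX1X // beta_momentZ mulrA pmulr_rgt0 //.
by apply: mulr_gt0; [apply: divr_gt0; lra | lra].
Qed.

Lemma beta_moment_mul_deriv_ge0 (R : realFieldType) (a b : R) (q : {poly R}) :
  0 < a -> a <= 1 -> a < b -> q.[0] = 0 -> 0 <= beta_moment a (b + 1) (q * q^`()).
Proof.
move=> a0 a1 ab q0; have [->|qn0] := eqVneq q 0; first by rewrite mul0r linear0.
exact/ltW/beta_moment_mul_deriv_gt0.
Qed.

(** * Resolvents, even and odd parts, and the energy inequality for them *)

Lemma deriv_sum (R : nzRingType) (m : nat) (F : 'I_m -> {poly R}) :
  (\sum_(i < m) F i)^`() = \sum_(i < m) (F i)^`().
Proof. exact: linear_sum. Qed.

(* The polynomial solution [r] of [r - nu r'' = p]. *)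
Definition resolvent {R : fieldType} (nu : R) (p : {poly R}) : {poly R} :=
  \sum_(j < size p) nu ^+ j *: p^`(2 * j).

(** The finite Neumann series of 1 - nu D^2 telescopes, and the last term is a derivative of too
    high an order to survive. *)
Lemma resolventP (R : fieldType) (nu : R) (p : {poly R}) :
  resolvent nu p - nu *: (resolvent nu p)^`()^`() = p.
Proof.
rewrite /resolvent !deriv_sum scaler_sumr -sumrB.
pose f j := - (nu ^+ j *: p^`(2 * j)).
transitivity (\sum_(0 <= j < size p) (f j.+1 - f j)).
  rewrite big_mkord; apply: eq_bigr => j _.
  by rewrite /f !derivZ -!derivnS mulnS exprS -scalerA opprK addrC.
rewrite telescope_sumr // /f poly.derivn_poly0 ?scaler0; last by lia.
by rewrite oppr0 sub0r opprK muln0 derivn0 expr0 scale1r.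
Qed.

Lemma size_resolvent (R : fieldType) (nu : R) (p : {poly R}) :
  (size (resolvent nu p) <= size p)%N.
Proof.
apply/leq_sizeP => j sj; rewrite coef_sum big1 // => i _.
by rewrite coefZ coef_derivn nth_default ?mul0rn ?mulr0 // (leq_trans sj) ?leq_addl.
Qed.

(** E_n of the overview; [odd_part] is O_n. The coefficients are the derivatives of even order of
    [jacobi a b n] at 0. *)
Definition even_part {R : fieldType} (a b : R) (n : nat) : {poly R} :=
  \poly_(k < (n./2).+1) jacobi_coef a b n (2 * k).

(* With a minus sign, so that all coefficients are nonnegative. *)
Definition odd_part {R : fieldType} (a b : R) (n : nat) : {poly R} :=
  \poly_(k < (n.-1./2).+1) - jacobi_coef a b n (2 * k).+1.

Lemma coef_even_part (R : fieldType) (a b : R) (n k : nat) :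
  (even_part a b n)`_k = jacobi_coef a b n (2 * k).
Proof.
by rewrite coef_poly; case: ltnP => // nk; rewrite jacobi_coef_eq0 //; lia.
Qed.

Lemma coef_odd_part (R : fieldType) (a b : R) (n k : nat) :
  (odd_part a b n)`_k = - jacobi_coef a b n (2 * k).+1.
Proof.
by rewrite coef_poly; case: ltnP => // nk; rewrite jacobi_coef_eq0 ?oppr0 //; lia.
Qed.

(** At 0 the Neumann series is the generating polynomial of the even derivatives; this is how E_n
    enters the energy argument. *)
Lemma resolvent_jacobi0 (R : realFieldType) (a b nu : R) (n : nat) :
  0 < a -> 0 < b -> (resolvent nu (jacobi a b n)).[0] = (even_part a b n).[nu].
Proof.
move=> a0 b0; rewrite horner_coef0 coef_sum.
rewrite (@horner_coef_wide _ n.+1) ?(leq_trans (size_poly _ _)) //; last by lia.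
rewrite size_jacobi // ?ltr_wpDl //; apply: eq_bigr => i _.
rewrite coefZ coef_derivn addn0 ffactnn coef_jacobi coef_even_part mulrC.
by rewrite -[_ *+ _]mulr_natr divfK // pnatr_eq0 -lt0n fact_gt0.
Qed.

Lemma deriv_resolvent_jacobi0 (R : realFieldType) (a b nu : R) (n : nat) :
  0 < a -> 0 < b -> (resolvent nu (jacobi a b n))^`().[0] = - (odd_part a b n).[nu].
Proof.
move=> a0 b0; rewrite horner_coef0 deriv_sum coef_sum.
rewrite (@horner_coef_wide _ n.+1) ?(leq_trans (size_poly _ _)) //; last by lia.
rewrite size_jacobi // ?ltr_wpDl // -sumrN; apply: eq_bigr => i _.
rewrite derivZ coefZ -derivnS coef_derivn addn0 ffactnn coef_jacobi coef_odd_part.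
rewrite mulNr opprK mulrC.
by rewrite -[_ *+ _]mulr_natr divfK // pnatr_eq0 -lt0n fact_gt0.
Qed.

Lemma beta_moment_jacobi_top (R : realFieldType) (a b : R) (n : nat) (q : {poly R}) :
  0 < a -> 0 < b -> (size q <= n.+1)%N ->
  beta_moment a (b + 1) (jacobi a b n * q) =
  q`_n * beta_moment a (b + 1) (jacobi a b n * 'X^n).
Proof.
move=> a0 b0 sq; have b1 : 0 < b + 1 by lra.
have nb : 0 < n%:R + b by rewrite ltr_wpDl.
rewrite -[q in LHS](subrK (q`_n *: 'X^n)) mulrDr beta_momentD -scalerAr beta_momentZ.
rewrite jacobi_orthogonal ?add0r //.
apply/leq_sizeP => j; rewrite leq_eqVlt coefB coefZ coefXn => /predU1P[<-|nj].
  by rewrite eqxx mulr1 subrr.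
by rewrite nth_default ?(leq_trans sq) // gtn_eqF // mulr0 subrr.
Qed.

(** The squared norm of P_n is its leading coefficient times the moment of P_n t^n, so these two
    have the same sign (-1)^n, opposite to that of the leading coefficient of P_(n+1). *)
Lemma jacobi_top_lt0 (R : realFieldType) (a b : R) (n : nat) : 0 < a -> a < b ->
  (jacobi a b n.+1)`_n.+1 * beta_moment a (b + 1) (jacobi a b n * 'X^n) < 0.
Proof.
move=> a0 ab; have b0 := lt_trans a0 ab.
have lead m : 0 < (-1) ^+ m * (jacobi a b m)`_m.
  rewrite coef_jacobi mulrA divr_gt0 ?ltr0n ?fact_gt0 //.
  by rewrite jacobi_coef_gt0 // ltr_wpDl.
have : 0 < beta_moment a (b + 1) (jacobi a b n * jacobi a b n).
  apply: beta_moment_sqr_gt0 => //; first by lra.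
  by rewrite -size_poly_eq0 size_jacobi // ltr_wpDl.
rewrite beta_moment_jacobi_top // ?size_jacobi ?ltr_wpDl //.
set t := beta_moment _ _ _; have := lead n; have := lead n.+1.
rewrite exprS mulN1r mulNr oppr_gt0.
have := sqrr_sign R n; move: ((-1) ^+ n) (_`_n) (_`_n.+1) => s x y s2 y0 x0 xt.
have xx : 0 < (s * x) * (s * x) by exact: mulr_gt0.
have : 0 < - (s * y) * (s * x) * (x * t) by do 2!apply: mulr_gt0 => //; rewrite oppr_gt0.
have -> : - (s * y) * (s * x) * (x * t) = (s * x * (s * x)) * (- (y * t)) by ring.
by rewrite pmulr_rgt0 // oppr_gt0.
Qed.

(* For [nu = - y^2] this is [Re (F_n.+1 (i y) / F_n (i y)) > 0], where
   [F_n z = even_part z^2 - z * odd_part z^2] is [\sum_k z^k D^k P_n] at [t = 0].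
   A combination [U + i y V] of the resolvents of [P_n] and [P_n.+1] which vanishes at
   [t = 0] is tested against its own derivative. *)
Lemma even_odd_part_gt0 (R : realFieldType) (a b nu : R) (n : nat) :
  0 < a -> a <= 1 -> a < b -> nu < 0 ->
  (even_part a b n).[nu] != 0 \/ (odd_part a b n).[nu] != 0 ->
  0 < (even_part a b n.+1).[nu] * (even_part a b n).[nu]
      - nu * ((odd_part a b n.+1).[nu] * (odd_part a b n).[nu]).
Proof.
move=> a0 a1 ab nu0; have b0 := lt_trans a0 ab.
have E0 m := resolvent_jacobi0 nu m a0 b0.
have O0 m : (odd_part a b m).[nu] = - (resolvent nu (jacobi a b m))^`().[0].
  by rewrite deriv_resolvent_jacobi0 // opprK.
rewrite -!E0 !O0 mulrNN oppr_eq0.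
have nb m : 0 < m%:R + b by rewrite ltr_wpDl.
have Hr := resolventP nu (jacobi a b n); have Hs := resolventP nu (jacobi a b n.+1).
have szr := size_resolvent nu (jacobi a b n).
have szs := size_resolvent nu (jacobi a b n.+1).
rewrite !size_jacobi // in szr szs.
(* A resolvent differs from its argument by a multiple of its own second derivative, so the top
   coefficient is kept. *)
have tops : (resolvent nu (jacobi a b n.+1))`_n.+1 = (jacobi a b n.+1)`_n.+1.
  rewrite -[in RHS]Hs coefB coefZ 2!coef_deriv (nth_default _ (leqW szs)).
  by rewrite !mul0rn mulr0 subr0.
move: Hr Hs szr szs tops.
set p := jacobi a b n; set P := jacobi a b n.+1.
set r := resolvent nu p; set s := resolvent nu P => Hr Hs szr szs tops.
set A := r.[0]; set B := r^`().[0]; set C := s.[0]; set D := s^`().[0] => AB.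
(* For z^2 = nu, u_n = r + z r' solves u - z u' = P_n and has value A + z B at 0; likewise for s
   with C + z D. U + z V expands (A + z B) u_(n+1) - (C + z D) u_n, which vanishes at 0; [EU] and
   [EV] are the two components of its equation. *)
pose U := A *: s + (nu * B) *: s^`() - C *: r - (nu * D) *: r^`().
pose V := A *: s^`() + B *: s - C *: r^`() - D *: r.
have U0 : U.[0] = 0 by rewrite /U !hornerE -/A -/B -/C -/D; ring.
have V0 : V.[0] = 0 by rewrite /V !hornerE -/A -/B -/C -/D; ring.
have EU : U - nu *: V^`() = A *: P - C *: p.
  rewrite -[in RHS]Hr -[in RHS]Hs /U /V !(derivD, derivN, derivZ).
  rewrite -!mul_polyC !polyCM; ring.
have EV : V - U^`() = B *: P - D *: p.
  rewrite -[in RHS]Hr -[in RHS]Hs /U /V !(derivD, derivN, derivZ).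
  rewrite -!mul_polyC !polyCM; ring.
have cs j : (n.+2 <= j)%N -> s`_j = 0 by move=> nj; rewrite nth_default ?(leq_trans szs).
have cr j : (n.+1 <= j)%N -> r`_j = 0 by move=> nj; rewrite nth_default ?(leq_trans szr).
have Utop : U`_n.+1 = A * P`_n.+1.
  by rewrite /U !(coefB, coefD, coefZ) !coef_deriv tops cs // !cr // !mul0rn; ring.
have Vtop : V`_n.+1 = B * P`_n.+1.
  by rewrite /V !(coefB, coefD, coefZ) !coef_deriv tops cs // !cr // !mul0rn; ring.
have szU : (size U <= n.+2)%N.
  apply/leq_sizeP => j nj; rewrite /U !(coefB, coefD, coefZ) !coef_deriv.
  by rewrite !cs ?(leqW nj) // !cr ?(ltnW nj) ?(leqW (ltnW nj)) // !mul0rn; ring.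
have szV : (size V <= n.+2)%N.
  apply/leq_sizeP => j nj; rewrite /V !(coefB, coefD, coefZ) !coef_deriv.
  by rewrite !cs ?(leqW nj) // !cr ?(ltnW nj) ?(leqW (ltnW nj)) // !mul0rn; ring.
pose L := @beta_moment R a (b + 1).
(* The derivative of W has degree at most n: P is orthogonal to it, and p only sees its top
   coefficient. *)
have test (W : {poly R}) : (size W <= n.+2)%N ->
    L (P * W^`()) = 0 /\ L (p * W^`()) = W`_n.+1 * (n.+1%:R * L (p * 'X^n)).
  move=> sW; have sW' : (size W^`()%R <= n.+1)%N by rewrite size_deriv; case: (size W) sW.
  split; first by rewrite /L jacobi_orthogonal //; lra.
  rewrite /L beta_moment_jacobi_top // coef_deriv -[_ *+ _]mulr_natr.
  by rewrite mulrA.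
have [[LPU LpU] [LPV LpV]] := (test _ szU, test _ szV).
(* Testing the first equation against U' and the second against V', with weight - nu, cancels the
   mixed terms in U' V'. *)
have key : L (U * U^`()) - nu * L (V * V^`()) =
    - (P`_n.+1 * L (p * 'X^n)) * n.+1%:R * (C * A - nu * (D * B)).
  have -> : L (U * U^`()) - nu * L (V * V^`()) =
      L ((A *: P - C *: p) * U^`()) - nu * L ((B *: P - D *: p) * V^`()).
    rewrite -EU -EV /L -!beta_momentZ -!linearB /=; congr beta_moment.
    by rewrite -!mul_polyC; ring.
  have LB x y (W : {poly R}) : L ((x *: P - y *: p) * W) = x * L (P * W) - y * L (p * W).
    by rewrite mulrBl -!scalerAl /L linearB /= !beta_momentZ.
  by rewrite !LB LPU LpU LPV LpV Utop Vtop; ring.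
have : 0 < L (U * U^`()) - nu * L (V * V^`()).
  (* Strictness: U or V has a nonzero top coefficient, according to which of A and B is nonzero. *)
  have top0 : P`_n.+1 != 0.
    by have := jacobi_top_lt0 n a0 ab; apply: contraTneq => ->; rewrite mul0r ltxx.
  have [A0|A0] := eqVneq A 0.
    apply: ltr_wpDl; first exact: beta_moment_mul_deriv_ge0.
    rewrite -mulNr; apply: mulr_gt0; first by rewrite oppr_gt0.
    apply: beta_moment_mul_deriv_gt0 => //.
    have B0 : B != 0 by case: AB; rewrite ?A0 ?eqxx.
    by apply: contra_eq_neq Vtop => ->; rewrite coef0 eq_sym mulf_neq0.
  apply: ltr_wpDr.
    rewrite -mulNr; apply: mulr_ge0; first by rewrite oppr_ge0 ltW.
    exact: beta_moment_mul_deriv_ge0.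
  apply: beta_moment_mul_deriv_gt0 => //.
  by apply: contra_eq_neq Utop => ->; rewrite coef0 eq_sym mulf_neq0.
rewrite key pmulr_rgt0 // mulr_gt0 ?ltr0n // oppr_gt0.
exact: jacobi_top_lt0.
Qed.

(** * Polynomials with negative simple roots, listed in decreasing order *)

(** The positive leading coefficient makes (-1)^k the sign of [p] at a point with exactly k roots to
    its right. *)
Definition dec_roots {R : realFieldType} (p : {poly R}) (d : nat) (e : nat -> R) : Prop :=
  [/\ 0 < lead_coef p, p = lead_coef p *: \prod_(0 <= i < d) ('X - (e i)%:P),
      forall i j, (i < j < d)%N -> e j < e i & forall i, (i < d)%N -> e i < 0].

Lemma horner_prod_XsubC (R : comNzRingType) (m d : nat) (e : nat -> R) (x : R) :
  (\prod_(m <= i < d) ('X - (e i)%:P)).[x] = \prod_(m <= i < d) (x - e i).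
Proof. by rewrite horner_prod; apply: eq_bigr => i _; rewrite hornerXsubC. Qed.

Lemma dec_roots_horner (R : realFieldType) (p : {poly R}) (d : nat) (e : nat -> R) (x : R) :
  dec_roots p d e -> p.[x] = lead_coef p * \prod_(0 <= i < d) (x - e i).
Proof.
by case=> _ Ep _ _; rewrite {1}Ep hornerZ horner_prod_XsubC.
Qed.

Lemma dec_roots_root (R : realFieldType) (p : {poly R}) (d i : nat) (e : nat -> R) :
  dec_roots p d e -> (i < d)%N -> p.[e i] = 0.
Proof.
move=> pe id; rewrite (dec_roots_horner _ pe) (big_cat_nat (n := i)) ?(ltnW id) //=.
by rewrite (big_ltn id) subrr mul0r !mulr0.
Qed.

Lemma dec_roots_rootP (R : realFieldType) (p : {poly R}) (d : nat) (e : nat -> R) (x : R) :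
  dec_roots p d e -> root p x -> exists2 i, (i < d)%N & x = e i.
Proof.
move=> pe; rewrite /root (dec_roots_horner _ pe) mulf_eq0 gt_eqF /=; last by case: pe.
rewrite prodf_seq_eq0 => /hasP[i]; rewrite mem_index_iota /= subr_eq0 => id /eqP xe.
by exists i.
Qed.

Lemma sign_prod_gt0 (R : realFieldType) (k : nat) (x : R) (e : nat -> R) :
  (forall i, (i < k)%N -> x < e i) -> 0 < (-1) ^+ k * \prod_(0 <= i < k) (x - e i).
Proof.
elim: k => [|k IH] xe; first by rewrite big_nil mulr1.
have -> : (-1) ^+ k.+1 * \prod_(0 <= i < k.+1) (x - e i) =
  ((-1) ^+ k * \prod_(0 <= i < k) (x - e i)) * (e k - x).
  by rewrite big_nat_recr //= exprS; ring.
by apply: mulr_gt0; [apply: IH => i ik; apply: xe; apply: leqW | rewrite subr_gt0 xe].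
Qed.

Lemma dec_roots_sign_gt0 (R : realFieldType) (p : {poly R}) (d k : nat) (e : nat -> R)
    (x : R) : dec_roots p d e -> (k <= d)%N ->
  (forall i, (i < k)%N -> x < e i) -> (forall i, (k <= i < d)%N -> e i < x) ->
  0 < (-1) ^+ k * p.[x].
Proof.
move=> pe kd lo hi; rewrite (dec_roots_horner _ pe) (big_cat_nat (n := k)) //=.
rewrite mulrCA; apply: mulr_gt0; first by case: pe.
rewrite mulrA; apply: mulr_gt0; first exact: sign_prod_gt0.
rewrite big_nat_cond; apply: prodr_gt0 => i; rewrite andbT => /hi.
by rewrite subr_gt0.
Qed.

(** As the roots decrease, comparing [x] with its two neighbours locates it among all of them; the
    form [i.+1 = k] makes the upper condition vacuous for k = 0. *)
Lemma dec_roots_nearby (R : realFieldType) (p : {poly R}) (d k : nat) (e : nat -> R)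
    (x : R) : dec_roots p d e -> (k <= d)%N ->
  (forall i, i.+1 = k -> x < e i) -> ((k < d)%N -> e k < x) -> 0 < (-1) ^+ k * p.[x].
Proof.
move=> pe kd lo hi; have [_ _ dec _] := pe.
apply: (dec_roots_sign_gt0 pe kd) => i.
  case: k kd lo {hi} => // k kd lo; rewrite ltnS leq_eqVlt => /predU1P[->|ik].
    exact: lo.
  by rewrite (lt_trans (lo k erefl)) // dec // ik.
case/andP; rewrite leq_eqVlt => /predU1P[<-|ki id]; first by move/hi.
by rewrite (lt_trans _ (hi (ltn_trans ki id))) // dec // ki.
Qed.

(** Only the term of the product rule that drops the factor at [e i] survives, and exactly [i] of
    its factors are negative. *)
Lemma dec_roots_deriv_gt0 (R : realFieldType) (p : {poly R}) (d i : nat) (e : nat -> R) :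
  dec_roots p d e -> (i < d)%N -> 0 < (-1) ^+ i * p^`().[e i].
Proof.
move=> [lc Ep dec _] id; rewrite Ep derivZ hornerZ mulrCA mulr_gt0 //.
rewrite (big_cat_nat (n := i)) ?(ltnW id) //= (big_ltn id).
rewrite !derivM derivXsubC !hornerE subrr /= !(mulr0, mul0r) add0r addr0.
rewrite mulrA mulr_gt0 //.
  by rewrite horner_prod_XsubC; apply: sign_prod_gt0 => j ji; rewrite dec // ji.
rewrite horner_prod_XsubC big_nat_cond; apply: prodr_gt0 => j; rewrite andbT => ij.
by rewrite subr_gt0 dec.
Qed.

Lemma horner_deriv_prod (R : fieldType) (d : nat) (e : nat -> R) (x : R) :
  (forall i, (i < d)%N -> x != e i) ->
  (\prod_(0 <= i < d) ('X - (e i)%:P))^`().[x] =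
  (\prod_(0 <= i < d) (x - e i)) * \sum_(0 <= i < d) (x - e i)^-1.
Proof.
elim: d => [|d IH] xe; first by rewrite !big_nil derivC horner0 mulr0.
rewrite !big_nat_recr //= derivM derivXsubC !hornerE IH => [|i id]; last exact/xe/leqW.
rewrite horner_prod_XsubC.
by field; rewrite subr_eq0 xe.
Qed.

(** The logarithmic derivative x p' / p of a polynomial p with roots [e]. *)
Definition euler_sum {R : fieldType} (d : nat) (e : nat -> R) (x : R) : R :=
  \sum_(0 <= i < d) x / (x - e i).

Lemma dec_roots_euler (R : realFieldType) (p : {poly R}) (d : nat) (e : nat -> R) (x : R) :
  dec_roots p d e -> (forall i, (i < d)%N -> x != e i) ->
  x * p^`().[x] = p.[x] * euler_sum d e x.
Proof.
move=> pe xe; rewrite (dec_roots_horner _ pe); case: pe => _ Ep _ _.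
rewrite {1}Ep derivZ hornerZ horner_deriv_prod // /euler_sum -mulr_sumr; ring.
Qed.

(** Each summand x / (x - e) increases on either side of its pole since e < 0; the last hypothesis
    says that no pole separates [x] from [y]. *)
Lemma euler_sum_le (R : realFieldType) (d : nat) (e : nat -> R) (x y : R) :
  (forall i, (i < d)%N -> e i < 0) -> x <= y ->
  (forall i, (i < d)%N -> 0 < (x - e i) * (y - e i)) ->
  euler_sum d e x <= euler_sum d e y.
Proof.
move=> neg xy side; rewrite /euler_sum big_nat_cond [leRHS]big_nat_cond.
apply: ler_sum => i; rewrite andbT => /= id.
have s := side i id; have e0 := neg i id.
have x0 : x - e i != 0 by apply: contraTneq s => ->; rewrite mul0r ltxx.
have y0 : y - e i != 0 by apply: contraTneq s => ->; rewrite mulr0 ltxx.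
rewrite -subr_ge0.
have -> : y / (y - e i) - x / (x - e i) = ((y - x) * - e i) / ((x - e i) * (y - e i)).
  by field; apply/andP.
by apply: divr_ge0; [apply: mulr_ge0; lra | exact: ltW].
Qed.

Lemma poly_sign_minfty (R : rcfType) (p : {poly R}) (d : nat) (x : R) :
  size p = d.+1 -> 0 < lead_coef p -> exists2 y, y < x & 0 < (-1) ^+ d * p.[y].
Proof.
move=> sp lc; pose q := (-1) ^+ d *: (p \Po - 'X).
have lq : lead_coef q = lead_coef p.
  rewrite lead_coefZ lead_coef_comp ?size_polyN ?size_polyX //.
  by rewrite lead_coefN lead_coefX sp /= mulrCA -expr2 sqrr_sign mulr1.
have [|m Hm] := @poly_pinfty_gt_lc _ q; first by rewrite lq.
exists (Num.min (- m) (x - 1)); first by rewrite gt_min; apply/orP; right; lra.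
set y := Num.min _ _; have : m <= - y by rewrite lerNr ge_min lexx.
move/Hm; rewrite lq /q hornerZ horner_comp hornerN hornerX opprK.
exact: lt_le_trans.
Qed.

Lemma nat_fun_exists (T : Type) (d : nat) (P : nat -> T -> Prop) (t0 : T) :
  (forall i, (i < d)%N -> exists u, P i u) ->
  exists e : nat -> T, forall i, (i < d)%N -> P i (e i).
Proof.
elim: d => [|d IH] H; first by exists (fun=> t0).
have [|e He] := IH; first by move=> i id; apply: H; apply: leqW.
have [u Hu] := H d (ltnSn d).
exists (fun i => if i == d then u else e i) => i; rewrite ltnS leq_eqVlt.
by case: eqP => [->|_] //= /He.
Qed.

Lemma dec_roots_intro (R : realFieldType) (p : {poly R}) (d : nat) (e : nat -> R) :
  size p = d.+1 -> 0 < lead_coef p -> (forall i, (i < d)%N -> p.[e i] = 0) ->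
  (forall i j, (i < j < d)%N -> e j < e i) -> (forall i, (i < d)%N -> e i < 0) ->
  dec_roots p d e.
Proof.
move=> sp lc rt dec neg; split=> //.
have inj : {in iota 0 d &, injective e}.
  move=> i j; rewrite !mem_iota /= => id jd eij.
  case: (ltngtP i j) => // ij; first by have := dec i j; rewrite ij jd eij ltxx => /(_ isT).
  by have := dec j i; rewrite ij id eij ltxx => /(_ isT).
rewrite {1}(@all_roots_prod_XsubC _ p [seq e i | i <- iota 0 d]).
- by rewrite big_map /index_iota subn0.
- by rewrite sp size_map size_iota.
- by apply/allP => x /mapP[i]; rewrite mem_iota => /= id ->; apply/rootP/rt.
- by rewrite uniq_rootsE map_inj_in_uniq ?iota_uniq.
Qed.

(** The intermediate value theorem gives a root between consecutive sample points, and the sign at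
    minus infinity gives one below the last. These are as many as the degree, hence all the
    roots. *)
Lemma dec_roots_exists (R : rcfType) (p : {poly R}) (d : nat) (x : nat -> R) :
  size p = d.+1 -> 0 < lead_coef p -> (forall i, (i < d)%N -> x i <= 0) ->
  (forall i, (i.+1 < d)%N -> x i.+1 < x i) ->
  (forall i, (i < d)%N -> 0 < (-1) ^+ i * p.[x i]) ->
  exists e, [/\ dec_roots p d e, forall i, (i < d)%N -> e i < x i
     & forall i, (i.+1 < d)%N -> x i.+1 < e i].
Proof.
move=> sp lc x0 xdec sgn.
have between u v k : u < v -> 0 < (-1) ^+ k * p.[v] -> 0 < (-1) ^+ k.+1 * p.[u] ->
    exists w, [/\ root p w, u < w & w < v].
  move=> uv pv pu; have [||w] := @poly_ivtoo _ p u v; first exact: ltW.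
    rewrite -oppr_gt0; have := mulr_gt0 pv pu; rewrite exprS.
    have -> : (-1) ^+ k * p.[v] * (-1 * (-1) ^+ k * p.[u]) =
      ((-1) ^+ k) ^+ 2 * - (p.[u] * p.[v]) by ring.
    by rewrite sqrr_sign mul1r.
  by rewrite in_itv /= => /andP[uw wv] rw; exists w.
have [|e He] := @nat_fun_exists R d
  (fun i u => [/\ root p u, u < x i & (i.+1 < d)%N -> x i.+1 < u]) 0.
  move=> i id; have [id1|id1] := ltnP i.+1 d.
    have [w [rw xw wx]] := between _ _ _ (xdec i id1) (sgn i id) (sgn _ id1).
    by exists w.
  have Ed : d = i.+1 by apply/eqP; rewrite eqn_leq id1 id.
  have [y yx py] := poly_sign_minfty (x i) sp lc.
  rewrite Ed in py; have [w [rw _ wx]] := between _ _ _ yx (sgn i id) py.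
  by exists w.
have step i : (i.+1 < d)%N -> e i.+1 < e i.
  move=> id; have [_ _ /(_ id) lo] := He i (ltnW id).
  by have [_ hi _] := He _ id; apply: lt_trans lo.
have dec i j : (i < j < d)%N -> e j < e i.
  elim: j => // j IH /andP[]; rewrite ltnS leq_eqVlt => /predU1P[->|ij] jd.
    exact: step.
  by rewrite (lt_trans (step _ jd)) // IH // ij ltnW.
exists e; split=> [|i id|i id]; last 2 first.
- by have [] := He i id.
- by have [_ _ /(_ id)] := He i (ltnW id).
apply: dec_roots_intro => // i id; first by have [/rootP-> _ _] := He i id.
by have [_ ex _] := He i id; apply: lt_le_trans ex (x0 i id).
Qed.

(** The chain e 0 > f 0 > e 1 > f 1 > ..., meant for d' = d or d' = d - 1, so that both parities of
    the degree share one definition. *)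
Definition alternate {R : realFieldType} (d d' : nat) (e f : nat -> R) : Prop :=
  (forall i, (i < d')%N -> f i < e i) /\ (forall i, (i.+1 < d)%N -> e i.+1 < f i).

Lemma dec_roots_le (R : realFieldType) (p : {poly R}) (d i j : nat) (e : nat -> R) :
  dec_roots p d e -> (i <= j)%N -> (j < d)%N -> e j <= e i.
Proof.
case=> _ _ dec _; rewrite leq_eqVlt => /predU1P[->//|ij jd].
by rewrite ltW // dec // ij.
Qed.

Lemma alternate_interlace (R : realFieldType) (p q : {poly R}) (d d' : nat)
    (e f : nat -> R) :
  dec_roots p d e -> dec_roots q d' f -> (d' <= d <= d'.+1)%N -> alternate d d' e f ->
  interlace p q.
Proof.
move=> pe qf /andP[d'd dd'] [fe ef].
have simple (r : {poly R}) k (g : nat -> R) : dec_roots r k g -> real_simple_zeros r.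
  move=> [lc Er dec _]; split; first by apply: contraTneq lc => ->; rewrite lead_coef0 ltxx.
  exists [seq g i | i <- iota 0 k]; split; last by rewrite {1}Er big_map /index_iota subn0.
  rewrite map_inj_in_uniq ?iota_uniq // => i j; rewrite !mem_iota /= => ik jk gij.
  case: (ltngtP i j) => // ij; first by have := dec i j; rewrite ij jk gij ltxx => /(_ isT).
  by have := dec j i; rewrite ij ik gij ltxx => /(_ isT).
(* Consecutive roots have adjacent indices, so the root of the other polynomial between them can be
   named by its index. *)
have consecutive (r : {poly R}) k (g : nat -> R) x y : dec_roots r k g ->
    root r x -> root r y -> x < y -> (forall z, x < z < y -> ~~ root r z) ->
    exists i, [/\ (i.+1 < k)%N, x = g i.+1 & y = g i].
  move=> rg /(dec_roots_rootP rg)[i ik ->] /(dec_roots_rootP rg)[j jk ->] xy none.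
  have [ij|ji] := leqP i j; first by move: xy; rewrite ltNge (dec_roots_le rg).
  move: ji; rewrite leq_eqVlt => /predU1P[Ei|ji].
    by exists j; rewrite Ei.
  have [_ _ dec _] := rg.
  have := none (g j.+1); rewrite !dec ?ji ?ltnSn ?(ltn_trans ji) // => /(_ isT)/negP[].
  by apply/rootP/(dec_roots_root rg); apply: ltn_trans ik.
split; [exact: simple pe | exact: simple qf | | |].
- move=> x [/(dec_roots_rootP pe)[i id ->] /(dec_roots_rootP qf)[j jd] eij].
  have [ij|ji] := leqP i j.
    have := lt_le_trans (fe j jd) (dec_roots_le pe ij (leq_trans jd d'd)).
    by rewrite eij ltxx.
  have := le_lt_trans (dec_roots_le pe ji id) (ef j (leq_ltn_trans ji id)).
  by rewrite eij ltxx.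
- move=> x y px py xy /(consecutive _ _ _ _ _ pe px py xy)[j [jd -> ->]].
  have jd' : (j < d')%N by rewrite -ltnS (leq_trans jd).
  exists (f j); split=> [|z [/andP[lo hi] /(dec_roots_rootP qf)[l ld Ez]]].
    by rewrite ef // fe //; split=> //; apply/rootP/(dec_roots_root qf).
  rewrite Ez in lo hi *; case: (ltngtP j l) => [jl|lj|->//].
    have := lt_le_trans (fe l ld) (dec_roots_le pe jl (leq_trans ld d'd)).
    by move/(lt_trans lo); rewrite ltxx.
  have := le_lt_trans (dec_roots_le pe lj (ltnW jd)) (ef l (leq_ltn_trans lj (ltnW jd))).
  by move/lt_trans/(_ hi); rewrite ltxx.
- move=> x y px py xy /(consecutive _ _ _ _ _ qf px py xy)[j [jd -> ->]].
  have jd' := leq_trans jd d'd.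
  exists (e j.+1); split=> [|z [/andP[lo hi] /(dec_roots_rootP pe)[l ld Ez]]].
    by rewrite ef // fe //; split=> //; apply/rootP/(dec_roots_root pe).
  rewrite Ez in lo hi *; case: (ltngtP j.+1 l) => [jl|lj|->//].
    have := le_lt_trans (dec_roots_le pe jl ld) (ef j.+1 (leq_ltn_trans jl ld)).
    by move/(lt_trans lo); rewrite ltxx.
  have := lt_le_trans (fe j (ltnW jd)) (dec_roots_le pe (lj : (l <= j)%N) (ltnW jd')).
  by move/lt_trans/(_ hi); rewrite ltxx.
Qed.

(** * Sign arguments for the induction on n *)

Lemma sign_mul_gt0 (R : realFieldType) (k : nat) (x y : R) :
  0 < (-1) ^+ k * y -> 0 < x * y -> 0 < (-1) ^+ k * x.
Proof.
have := sqrr_sign R k; move: ((-1) ^+ k) => s s2 sy xy.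
rewrite -(pmulr_lgt0 _ sy); have -> : s * x * (s * y) = s ^+ 2 * (x * y) by ring.
by rewrite s2 mul1r.
Qed.

Lemma sign_alt (R : realFieldType) (k : nat) (x : R) :
  0 < (-1) ^+ k * x -> 0 < (-1) ^+ k.+1 * x -> False.
Proof. by rewrite exprS mulN1r mulNr oppr_gt0 => /lt_trans h /h; rewrite ltxx. Qed.

(** The primed data belong to n, the others to n + 1. At a root of E' the inequality says that O and
    O' have the same sign, since x < 0; at a root of O' it says so for E and E'. These signs
    alternate along the roots, which locates the roots of O and E. *)
Lemma alternate_step (R : rcfType) (E' O' E O : {poly R}) (d k : nat) (e' o' : nat -> R) :
  (k <= d <= k.+1)%N ->
  dec_roots E' d e' -> dec_roots O' k o' -> alternate d k e' o' ->
  size E = k.+2 -> size O = d.+1 -> 0 < lead_coef E -> 0 < lead_coef O -> 0 < E.[0] ->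
  (forall x, x < 0 -> E'.[x] != 0 \/ O'.[x] != 0 ->
     0 < E.[x] * E'.[x] - x * (O.[x] * O'.[x])) ->
  exists e o, [/\ dec_roots E k.+1 e, dec_roots O d o, alternate k.+1 d e o,
    alternate d d e' o & alternate k.+1 k e o'].
Proof.
move=> /andP[kd dk] rE' rO' [oe eo] szE szO lE lO E0 pos.
have [_ _ dece' nege'] := rE'; have [_ _ deco' nego'] := rO'.
have nz (x : R) m : 0 < (-1) ^+ m * x -> x != 0.
  by apply: contraTneq => ->; rewrite mulr0 ltxx.
have sO' i : (i < d)%N -> 0 < (-1) ^+ i * O'.[e' i].
  move=> id; apply: (dec_roots_nearby rO'); first by rewrite -ltnS (leq_trans id).
    by move=> j ji; rewrite -ji eo // ji.
  exact: oe.
have sE' i : (i < k)%N -> 0 < (-1) ^+ i.+1 * E'.[o' i].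
  move=> ik; apply: (dec_roots_nearby rE'); first exact: leq_trans kd.
    by move=> j [->]; apply: oe.
  exact: eo.
have [||i id|o [rO oe' e'o]] := dec_roots_exists (x := e') szO lO.
- by move=> i id; rewrite ltW ?nege'.
- by move=> i id; rewrite dece' // ltnSn.
- apply: sign_mul_gt0 (sO' i id) _.
  have := pos _ (nege' i id) (or_intror (nz _ _ (sO' i id))).
  rewrite (dec_roots_root rE') // mulr0 sub0r -mulNr pmulr_rgt0 //.
  by rewrite oppr_gt0 nege'.
(* The largest root of E lies between o' 0 and 0, so 0, where E is positive, is the first sample
   point. *)
pose x i := if i is j.+1 then o' j else 0 : R.
have [|||e [rE ex xe]] := dec_roots_exists (x := x) szE lE.
- by case=> [|i] //=; rewrite ltnS => ik; rewrite ltW ?nego'.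
- by case=> [|i]; rewrite !ltnS /= => ik; [exact: nego' | rewrite deco' // ltnSn].
- case=> [|i]; first by rewrite mul1r.
  rewrite ltnS => ik; apply: sign_mul_gt0 (sE' i ik) _.
  have := pos _ (nego' i ik) (or_introl (nz _ _ (sE' i ik))).
  by rewrite (dec_roots_root rO') // !mulr0 subr0.
have [_ _ deco nego] := rO.
(* The position of o i among the roots of E' gives the sign of E' there, and where O vanishes the
   inequality gives E the same sign. *)
have sE i : (i < d)%N -> 0 < (-1) ^+ i.+1 * E.[o i].
  move=> id; have sgn : 0 < (-1) ^+ i.+1 * E'.[o i].
    apply: (dec_roots_nearby rE') => //; last exact: e'o.
    by move=> j [->]; apply: oe'.
  apply: (sign_mul_gt0 sgn).
  have := pos _ (nego i id) (or_introl (nz _ _ sgn)).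
  by rewrite (dec_roots_root rO) // mul0r mulr0 subr0.
(* If e and o failed to alternate, the bounds through e' and o' would give E the opposite sign at
   some o i. *)
exists e, o; split=> //; split=> i.
- move=> id; rewrite ltNge; apply/negP; rewrite le_eqVlt => /predU1P[eo_i|lt_eo].
    by have := nz _ _ (sE i id); rewrite -eo_i (dec_roots_root rE) ?eqxx // (leq_trans id).
  apply: (@sign_alt _ i E.[o i]); last exact: sE.
  apply: (dec_roots_nearby rE) => [|j ji|//]; first exact: leq_trans (ltnW id) dk.
  rewrite -{}ji in id lt_eo *.
  apply: lt_trans (oe' _ id) _; apply: lt_trans (eo _ id) _.
  exact: (xe j (leq_trans id dk)).
- rewrite ltnS => ik; have id := leq_trans ik kd.
  rewrite ltNge; apply/negP; rewrite le_eqVlt => /predU1P[oe_i|lt_oe].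
    by have := nz _ _ (sE i id); rewrite oe_i (dec_roots_root rE) ?eqxx.
  apply: (@sign_alt _ i.+1 E.[o i]); first exact: sE.
  apply: (dec_roots_nearby rE) => [//|j [->]//|]; rewrite ltnS => ik2.
  apply: lt_trans (ex _ _) _ => //=; apply: lt_trans (oe _ ik2) _.
  by apply: e'o; apply: leq_trans ik2 kd.
- by move=> ik; apply: (xe i).
- by rewrite ltnS => ik; apply: (ex i.+1).
Qed.

(* Both sides of the differential relation change sign between consecutive [e' i]; were
   [e' i] above [e i], this would contradict the monotonicity of [x f' / f] between
   consecutive roots of [f]. *)
Lemma dec_roots_lt (R : realFieldType) (f g : {poly R}) (d d' : nat) (e e' : nat -> R)
    (A N B M : R) :
  dec_roots f d e -> dec_roots g d' e' -> (d' <= d)%N ->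
  0 < A -> 0 <= N -> 0 < B ->
  (forall x, A * (N * f.[x] - 2 * (x * f^`().[x])) = B * (M * g.[x] + 2 * (x * g^`().[x]))) ->
  (forall i, (i.+1 < d')%N -> e' i.+1 < e i) ->
  forall i, (i < d')%N -> e' i < e i.
Proof.
move=> rf rg dd A0 N0 B0 rel shift.
have [_ _ decf negf] := rf; have [_ _ decg negg] := rg.
have rel' i : (i < d')%N ->
    A * (N * f.[e' i] - 2 * (e' i * f^`().[e' i])) = 2 * B * (e' i * g^`().[e' i]).
  by move=> id; rewrite rel (dec_roots_root rg) //; ring.
have sg i : (i < d')%N -> 0 < (-1) ^+ i * g^`().[e' i] by apply: dec_roots_deriv_gt0.
(* At a root of g, dividing the relation by f gives N - 2 x f' / f, whose sign is read from f and
   g'. *)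
have slope i k : (i < d')%N -> (forall l, (l < d)%N -> e' i != e l) ->
    0 < (-1) ^+ k * f.[e' i] ->
    exists2 c, 0 < c & N - 2 * euler_sum d e (e' i) = - (c * ((-1) ^+ k * g^`().[e' i])).
  move=> id ne sf; have := rel' i id; rewrite (dec_roots_euler rf) // => eq.
  have c0 : 0 < A * ((-1) ^+ k * f.[e' i]) by apply: mulr_gt0.
  have c1 : 0 < 2 * B * - e' i by rewrite mulr_gt0 ?mulr_gt0 // oppr_gt0 negg.
  exists (2 * B * - e' i / (A * ((-1) ^+ k * f.[e' i]))); first exact: divr_gt0.
  apply: (mulfI (lt0r_neq0 c0)).
  transitivity ((-1) ^+ k * (A * (N * f.[e' i] - 2 * (f.[e' i] * euler_sum d e (e' i))))).
    by ring.
  rewrite eq mulrN [in RHS]mulrA [_ * (2 * B * - e' i / _)]mulrC divfK ?gt_eqF //.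
  by ring.
have sep i l : (i < d')%N -> (forall j, j.+1 = i -> e' i < e j) -> e i < e' i ->
    (l < d)%N -> if (l < i)%N then e' i < e l else e l < e' i.
  move=> id lo hi ld; case: ltnP => [li|il].
    case: i li id lo {hi} => // j lj jd lo.
    have jd' := ltnW (leq_trans jd dd).
    by apply: lt_le_trans (lo j erefl) (dec_roots_le rf (lj : (l <= j)%N) jd').
  exact: le_lt_trans (dec_roots_le rf il ld) hi.
have avoid i : (i < d')%N -> (forall j, j.+1 = i -> e' i < e j) -> e i < e' i ->
    forall l, (l < d)%N -> e' i != e l.
  move=> id lo hi l ld; have := sep i l id lo hi ld.
  by case: ifP => _ h; rewrite ?(lt_eqF h) ?(gt_eqF h).
(* At a common root the relation becomes - A f' = B g', while both derivatives have the sign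
   (-1)^i. *)
have collide i : (i < d')%N -> e i != e' i.
  move=> id; apply/eqP => ee; have := rel' i id.
  have sf := dec_roots_deriv_gt0 rf (leq_trans id dd).
  rewrite -{1}ee (dec_roots_root rf) ?(leq_trans id) // mulr0 sub0r => eq.
  have : 0 < - e' i * ((-1) ^+ i * f^`().[e i]) * A.
    by rewrite mulr_gt0 // mulr_gt0 // oppr_gt0 negg.
  have : 0 < - e' i * ((-1) ^+ i * g^`().[e' i]) * B.
    by rewrite mulr_gt0 // mulr_gt0 ?sg // oppr_gt0 negg.
  rewrite ee; have : (-1) ^+ i * (A * - (2 * (e' i * f^`().[e' i]))) =
    (-1) ^+ i * (2 * B * (e' i * g^`().[e' i])) by rewrite eq.
  move: ((-1) ^+ i) (e' i) (f^`().[_]) (g^`().[_]) => s y u v; nra.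
have negative i : (i < d')%N -> (forall j, j.+1 = i -> e' i < e j) -> e i < e' i ->
    N - 2 * euler_sum d e (e' i) < 0.
  move=> id lo hi; have id' := leq_trans id dd.
  have [|c c0 ->] := slope i i id (avoid i id lo hi).
    exact: (dec_roots_nearby rf (ltnW id')).
  by rewrite oppr_lt0 mulr_gt0 // sg.
(* For i = 0 the comparison point is 0, where the Euler sum vanishes and N >= 0. Afterwards it is e'
   i, which by induction lies in the same gap between roots of f as e' i.+1. *)
elim=> [|i IH] id; rewrite ltNge le_eqVlt negb_or collide //=; apply/negP => hi.
  have lo j : j.+1 = 0%N -> e' 0%N < e j by [].
  have := negative 0%N id lo hi.
  have : euler_sum d e (e' 0%N) <= euler_sum d e 0.
    apply: euler_sum_le => // [|l ld]; first exact/ltW/negg.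
    have := sep 0%N l id lo hi ld; rewrite ltn0 => h.
    by rewrite mulr_gt0 ?subr_gt0 // negf.
  have -> : euler_sum d e 0 = 0 by rewrite /euler_sum big1 // => l _; rewrite mul0r.
  by lra.
have lo j : j.+1 = i.+1 -> e' i.+1 < e j by move=> [->]; apply: shift.
have := negative _ id lo hi; have id1 := ltnW id.
have gt_i : e' i.+1 < e' i by rewrite decg // ltnSn.
have sep' l : (l < d)%N -> if (l < i.+1)%N then e' i < e l else e l < e' i.
  move=> ld; have := sep _ l id lo hi ld; case: ltnP => [li _|_ h]; last exact: lt_trans gt_i.
  by apply: lt_le_trans (IH id1) (dec_roots_le rf (li : (l <= _)%N) (leq_trans id1 dd)).
have [l ld||c c0 e_i] := slope i i.+1 id1.
- by have := sep' l ld; case: ifP => _ h; rewrite ?(lt_eqF h) ?(gt_eqF h).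
- apply: (dec_roots_nearby rf); first exact: leq_trans id1 dd.
    by move=> j [->]; apply: IH.
  by move=> ld; have := sep' _ ld; rewrite ltnn.
have : 0 < N - 2 * euler_sum d e (e' i).
  by rewrite e_i exprS mulN1r mulNr mulrN opprK mulr_gt0 // sg.
have : euler_sum d e (e' i.+1) <= euler_sum d e (e' i).
  apply: euler_sum_le => // [|l ld]; first exact: ltW.
  have := sep _ l id lo hi ld; have := sep' l ld; case: ifP => _ h1 h2.
    by rewrite nmulr_rgt0 subr_lt0.
  by rewrite mulr_gt0 ?subr_gt0.
by lra.
Qed.

(** * Interlacing *)

Lemma even_part_top (R : realFieldType) (a b : R) (n : nat) : 0 < a -> 0 < b ->
  size (even_part a b n) = (n./2).+1 /\ 0 < lead_coef (even_part a b n).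
Proof.
move=> a0 b0; have top : 0 < jacobi_coef a b n (2 * n./2).
  have nn : (2 * n./2 <= n)%N by lia.
  have := jacobi_coef_gt0 a0 (ltr_wpDl (ler0n R n) b0) nn.
  by rewrite mulnC exprM sqrr_sign mul1r.
have sz : size (even_part a b n) = (n./2).+1 by rewrite size_poly_eq // gt_eqF.
by rewrite lead_coefE sz coef_even_part.
Qed.

Lemma odd_part_top (R : realFieldType) (a b : R) (n : nat) :
  0 < a -> 0 < b -> (0 < n)%N ->
  size (odd_part a b n) = (n.-1./2).+1 /\ 0 < lead_coef (odd_part a b n).
Proof.
move=> a0 b0 n0; have top : 0 < - jacobi_coef a b n (2 * n.-1./2).+1.
  have nn : ((2 * n.-1./2).+1 <= n)%N by lia.
  have := jacobi_coef_gt0 a0 (ltr_wpDl (ler0n R n) b0) nn.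
  by rewrite exprS mulnC exprM sqrr_sign mulr1 mulN1r.
have sz : size (odd_part a b n) = (n.-1./2).+1 by rewrite size_poly_eq // gt_eqF.
by rewrite lead_coefE sz coef_odd_part.
Qed.

Lemma even_part0 (R : fieldType) (a b : R) (n : nat) : (even_part a b n).[0] = 1.
Proof. by rewrite horner_coef0 coef_even_part jacobi_coef0. Qed.

(** Passing from n to n + 1 changes each of the two Pochhammer symbols in n by one factor at either
    end. *)
Lemma jacobi_coef_contiguous (R : fieldType) (a b : R) (n k : nat) :
  (n%:R + b) * (n.+1%:R - k%:R) * jacobi_coef a b n.+1 k =
  n.+1%:R * (n%:R + b + k%:R) * jacobi_coef a b n k.
Proof.
have e1 : poch (- n.+1%:R : R) k * (n.+1%:R - k%:R) = n.+1%:R * poch (- n%:R) k.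
  have := pochSl (- n.+1%:R : R) k; rewrite pochS.
  have -> : - n.+1%:R + 1 = - n%:R :> R by rewrite -natr1; ring.
  move=> e; transitivity (- (poch (- n.+1%:R) k * (- n.+1%:R + k%:R : R))); first by ring.
  by rewrite e; ring.
have e2 : poch (n.+1%:R + b) k * (n%:R + b) = poch (n%:R + b) k * (n%:R + b + k%:R).
  rewrite -pochS pochSl mulrC; congr (_ * poch _ _).
  by rewrite -natr1; ring.
rewrite /jacobi_coef.
transitivity ((poch (- n.+1%:R) k * (n.+1%:R - k%:R))
   * (poch (n.+1%:R + b) k * (n%:R + b)) / poch a k); first by ring.
by rewrite e1 e2; ring.
Qed.

(** On the coefficient of x^k the operator 2 x d/dx is multiplication by 2k, so this is
    [jacobi_coef_contiguous] at the index 2k. *)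
Lemma even_part_contiguous (R : fieldType) (a b x : R) (n : nat) :
  (n%:R + b) * (n.+1%:R * (even_part a b n.+1).[x]
                - 2 * (x * (even_part a b n.+1)^`().[x])) =
  n.+1%:R * ((n%:R + b) * (even_part a b n).[x] + 2 * (x * (even_part a b n)^`().[x])).
Proof.
have /(congr1 (horner^~ x)) :
    (n%:R + b) *: (n.+1%:R *: even_part a b n.+1 - 2 *: ('X * (even_part a b n.+1)^`())) =
    n.+1%:R *: ((n%:R + b) *: even_part a b n + 2 *: ('X * (even_part a b n)^`())).
  apply/polyP => k; rewrite !(coefZ, coefD, coefN) !coefXderiv !coef_even_part.
  have := jacobi_coef_contiguous a b n (2 * k); rewrite natrM => e.
  transitivity ((n%:R + b) * (n.+1%:R - 2 * k%:R) * jacobi_coef a b n.+1 (2 * k)).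
    by ring.
  by rewrite e; ring.
by rewrite !hornerE.
Qed.

Lemma odd_part_contiguous (R : fieldType) (a b x : R) (n : nat) :
  (n%:R + b) * (n%:R * (odd_part a b n.+1).[x]
                - 2 * (x * (odd_part a b n.+1)^`().[x])) =
  n.+1%:R * ((n%:R + b + 1) * (odd_part a b n).[x] + 2 * (x * (odd_part a b n)^`().[x])).
Proof.
have /(congr1 (horner^~ x)) :
    (n%:R + b) *: (n%:R *: odd_part a b n.+1 - 2 *: ('X * (odd_part a b n.+1)^`())) =
    n.+1%:R *: ((n%:R + b + 1) *: odd_part a b n + 2 *: ('X * (odd_part a b n)^`())).
  apply/polyP => k; rewrite !(coefZ, coefD, coefN) !coefXderiv !coef_odd_part.
  have := jacobi_coef_contiguous a b n (2 * k).+1.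
  have -> : n.+1%:R - (2 * k).+1%:R = n%:R - 2 * k%:R :> R by rewrite -!natr1 natrM; ring.
  have -> : n%:R + b + (2 * k).+1%:R = n%:R + b + 1 + 2 * k%:R by rewrite -natr1 natrM; ring.
  move=> e.
  transitivity (- ((n%:R + b) * (n%:R - 2 * k%:R) * jacobi_coef a b n.+1 (2 * k).+1)).
    by ring.
  by rewrite e; ring.
by rewrite !hornerE.
Qed.

(** The root condition of the Hermite-Biehler theorem for F_n(z) = E_n(z^2) - z O_n(z^2) to have all
    its zeros in the right half-plane. *)
Definition hermite_biehler {R : realFieldType} (a b : R) (n : nat) (e o : nat -> R) : Prop :=
  [/\ dec_roots (even_part a b n) n./2 e, dec_roots (odd_part a b n) n.-1./2 o
    & alternate n./2 n.-1./2 e o].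

(** The energy inequality feeds [alternate_step] and the contiguous relations feed [dec_roots_lt].
    The shift hypothesis of the latter is e' i.+1 < o' i < e i for the even parts and o' i.+1 < e'
    i.+1 < o i for the odd parts. *)
Lemma hermite_biehler_step (R : rcfType) (a b : R) (n : nat) (e' o' : nat -> R) :
  0 < a -> a <= 1 -> a < b -> (0 < n)%N -> hermite_biehler a b n e' o' ->
  exists e o, [/\ hermite_biehler a b n.+1 e o,
    alternate n./2 n./2 e' o, alternate n.+1./2 n.-1./2 e o',
    forall i, (i < n./2)%N -> e' i < e i & forall i, (i < n.-1./2)%N -> o' i < o i].
Proof.
move=> a0 a1 ab n0 [rE' rO' eo']; have b0 := lt_trans a0 ab.
have [sE lE] := even_part_top n.+1 a0 b0.
have [sO lO] := odd_part_top (n := n.+1) a0 b0 isT.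
have En : n.+1./2 = (n.-1./2).+1 by lia.
rewrite /= in sO; rewrite En in sE.
have dk : (n.-1./2 <= n./2 <= (n.-1./2).+1)%N by lia.
have [||e [o [rE rO eo e'o eo'']]] := alternate_step dk rE' rO' eo' sE sO lE lO.
- by rewrite even_part0.
- by move=> x x0; apply: even_odd_part_gt0.
exists e, o; rewrite /hermite_biehler En; split=> //.
- apply: (dec_roots_lt rE rE' _ _ _ _ (fun x => even_part_contiguous a b x n)) => //; try lia.
  + by rewrite ltr_wpDl.
  + move=> i id; have [oe _] := eo''; have [_ e'o'] := eo'.
    by apply: lt_trans (e'o' _ id) (oe _ _); lia.
- apply: (dec_roots_lt rO rO' _ _ _ _ (fun x => odd_part_contiguous a b x n)) => //; try lia.
  + by rewrite ltr_wpDl.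
  + move=> i id; have [oe _] := eo'; have [_ eo1] := e'o.
    by apply: lt_trans (oe _ id) (eo1 _ _); lia.
Qed.

Lemma hermite_biehler_exists (R : rcfType) (a b : R) (n : nat) :
  0 < a -> a <= 1 -> a < b -> (0 < n)%N -> exists e o, hermite_biehler a b n e o.
Proof.
move=> a0 a1 ab; have b0 := lt_trans a0 ab; elim: n => // n IH _.
have [->|n0] := posnP n.
  (* For n = 1 both parts are constants, so the root lists are empty. *)
  have [sE lE] := even_part_top 1 a0 b0.
  have [sO lO] := odd_part_top (n := 1) a0 b0 isT.
  exists (fun=> 0), (fun=> 0); split; try by split.
    by apply: dec_roots_intro => // i j; rewrite ltn0 andbF.
  by apply: dec_roots_intro => // i j; rewrite ltn0 andbF.
have [e' [o' hb]] := IH n0.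
by have [e [o [hb' _ _ _ _]]] := hermite_biehler_step a0 a1 ab n0 hb; exists e, o.
Qed.

(** One bound comes from the growth of each root over two steps, the other from passing through a
    root of the opposite part at index n + 1. *)
Lemma hermite_biehler_two (R : rcfType) (a b : R) (n : nat) :
  0 < a -> a <= 1 -> a < b -> (0 < n)%N -> exists e o e2 o2,
  [/\ hermite_biehler a b n.+2 e o, hermite_biehler a b n e2 o2,
      alternate n.+2./2 n./2 e e2 & alternate n.+1./2 n.-1./2 o o2].
Proof.
move=> a0 a1 ab n0; have [e2 [o2 hb2]] := hermite_biehler_exists a0 a1 ab n0.
have [e1 [o1 [hb1 r1 q1 ee1 oo1]]] := hermite_biehler_step a0 a1 ab n0 hb2.
have [e [o [hb r q ee oo]]] := hermite_biehler_step a0 a1 ab (isT : (0 < n.+1)%N) hb1.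
exists e, o, e2, o2; split=> //; split=> i id.
- by apply: lt_trans (ee1 i id) (ee i _); lia.
- by apply: lt_trans (q.2 i id) (r1.1 i _); lia.
- by apply: lt_trans (oo1 i id) (oo i _); rewrite /=; lia.
- exact: lt_trans (r.1 _ id) (q1.2 i id).
Qed.

(** * Transfer from even and odd parts to [phi] *)

Lemma dec_roots_rescale (R : realFieldType) (f p : {poly R}) (d : nat) (e : nat -> R)
    (c s : R) :
  0 < c -> 0 < s -> size f = d.+1 -> dec_roots f d e ->
  (forall k, p`_k = c * (f`_k / s ^+ k)) -> dec_roots p d (fun i => s * e i).
Proof.
move=> c0 s0 sf rf Ep; have [lf _ dec neg] := rf.
have pk k : (p`_k == 0) = (f`_k == 0).
  by rewrite Ep !mulf_eq0 invr_eq0 expf_eq0 !(gt_eqF c0, gt_eqF s0) andbF orbF.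
have top : 0 < p`_d.
  by rewrite Ep mulr_gt0 // divr_gt0 ?exprn_gt0 //; move: lf; rewrite lead_coefE sf.
have sp : size p = d.+1.
  apply/eqP; rewrite eqn_leq; apply/andP; split.
    by apply/leq_sizeP => j dj; apply/eqP; rewrite pk nth_default ?sf.
  by rewrite ltnNge; apply: contraTN top => /leq_sizeP->; rewrite ?ltxx.
apply: dec_roots_intro; rewrite ?lead_coefE ?sp //.
- move=> i id; rewrite horner_coef sp.
  transitivity (c * f.[e i]); last by rewrite (dec_roots_root rf) ?mulr0.
  rewrite horner_coef sf mulr_sumr; apply: eq_bigr => k _.
  by rewrite Ep exprMn; field; rewrite expf_neq0 // gt_eqF.
- by move=> i j ij; rewrite ltr_pM2l // dec.
- by move=> i id; rewrite pmulr_rlt0 // neg.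
Qed.

Lemma coef_phi (R : fieldType) (n k : nat) (al be : R) :
  (phi n al be)`_k = poch (al + 1) n / (n`!)%:R *
    (jacobi_coef (al + 1) (al + be + 1) n (2 * k) / 4 ^+ k).
Proof.
rewrite /phi coefZ; congr (_ * _); rewrite /jacobi_coef !addrA.
rewrite -(poly_def (n./2).+1 (fun k => poch (- n%:R) (2 * k)
  * poch (n%:R + al + be + 1) (2 * k) / poch (al + 1) (2 * k) / 4 ^+ k)).
rewrite coef_poly; case: ltnP => // nk.
by rewrite pochN_eq0 ?mul0r //; lia.
Qed.

Lemma poch_div_fact_gt0 (R : realFieldType) (a : R) (n : nat) :
  0 < a -> 0 < poch a n / (n`!)%:R.
Proof. by move=> a0; rewrite divr_gt0 ?poch_gt0 // ltr0n fact_gt0. Qed.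

Lemma dec_roots_phi (R : realFieldType) (n : nat) (al be : R) (e : nat -> R) :
  0 < al + 1 -> 0 < al + be + 1 ->
  dec_roots (even_part (al + 1) (al + be + 1) n) n./2 e ->
  dec_roots (phi n al be) n./2 (fun i => 4 * e i).
Proof.
move=> a0 b0 rE; have [sE _] := even_part_top n a0 b0.
apply: (dec_roots_rescale (poch_div_fact_gt0 n a0) _ sE rE) => [|k]; first by lra.
by rewrite coef_even_part coef_phi.
Qed.

(** The derivative of a Jacobi polynomial of degree n + 1 is a multiple of the one of degree n with
    both parameters raised by one. Here this means splitting off the first factor of each Pochhammer
    symbol. *)
Lemma dec_roots_phi_shift (R : realFieldType) (n : nat) (al be : R) (o : nat -> R) :
  0 < al + 1 -> 0 < al + be + 1 ->
  dec_roots (odd_part (al + 1) (al + be + 1) n.+1) n./2 o ->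
  dec_roots (phi n (al + 1) (be + 1)) n./2 (fun i => 4 * o i).
Proof.
move=> a0 b0 rO; have [sO _] := odd_part_top (n := n.+1) a0 b0 isT.
set a := al + 1 in a0 rO sO *; set b := al + be + 1 in b0 rO sO *.
have nb : 0 < n.+1%:R + b by rewrite ltr_wpDl.
(* The second factor inverts the split-off factors (n + 1)(n + 1 + b) / a. *)
have c0 : 0 < poch (a + 1) n / (n`!)%:R * (a / (n.+1%:R * (n.+1%:R + b))).
  apply: mulr_gt0; first by apply: poch_div_fact_gt0; lra.
  by rewrite divr_gt0 // mulr_gt0.
apply: (dec_roots_rescale c0 _ sO rO) => [|k]; first by lra.
rewrite coef_odd_part coef_phi -/a /jacobi_coef !pochSl.
have -> : - n.+1%:R + 1 = - n%:R :> R by rewrite -natr1; ring.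
have -> : n%:R + (a + (be + 1) + 1) = n.+1%:R + b + 1 by rewrite /a /b -natr1; ring.
have p0 : 0 < poch (a + 1) (2 * k) by apply: poch_gt0; lra.
have f0 : 0 < (n`!)%:R :> R by rewrite ltr0n fact_gt0.
by field; rewrite ?nat1r !(gt_eqF a0, gt_eqF p0, gt_eqF f0, gt_eqF nb) ?expf_neq0 ?pnatr_eq0.
Qed.

Theorem theorem10 (R : rcfType) (al be : R) (n : nat) :
  -1 < al -> al < 0 -> 0 < be -> (5 <= n)%N ->
  interlace (phi n (al + 1) (be + 1)) (phi (n - 2) (al + 1) (be + 1)) /\
  interlace (phi n al be) (phi (n - 2) al be).
Proof.
move=> al1 al0 be0; case: n => [|[|m]] // m3; rewrite -addn2 addnK addn2.
have a0 : 0 < al + 1 by lra.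
have a1 : al + 1 <= 1 by lra.
have ab : al + 1 < al + be + 1 by lra.
have b0 := lt_trans a0 ab.
have scale d d' (e f : nat -> R) : alternate d d' e f ->
    alternate d d' (fun i => 4 * e i) (fun i => 4 * f i).
  by move=> [h1 h2]; split=> i id; rewrite ltr_pM2l ?h1 ?h2.
have [e [o [e2 [o2 [[rE _ _] [rE2 _ _] ee2 _]]]]] :=
  hermite_biehler_two a0 a1 ab (ltnW (ltnW m3)).
(* The odd parts are taken one index higher, since the shifted [phi] of degree index n comes from
   the odd part of index n + 1. *)
have [f [g [f2 [g2 [[_ rO _] [_ rO2 _] _ oo2]]]]] :=
  hermite_biehler_two a0 a1 ab (isT : (0 < m.+1)%N).
split.
  apply: (alternate_interlace (dec_roots_phi_shift a0 b0 rO) (dec_roots_phi_shift a0 b0 rO2)).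
    by rewrite /= leqnSn leqnn.
  exact: scale.
apply: (alternate_interlace (dec_roots_phi a0 b0 rE) (dec_roots_phi a0 b0 rE2)).
  by rewrite /= leqnSn leqnn.
exact: scale.
Qed.
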